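(* Let $K$ be a number field of degree $n$ over $\mathbb{Q}$ with ring of integers $\mathcal{O}$, and let $\Delta(u_1,\dots,u_n)\in\mathbb{Z}[u_1,\dots,u_n]$ be the primitive form obtained from the discriminant of the fundamental equation of $K$. A rational prime $p$ is a common inessential discriminant divisor for $K$ if and only if $\Delta(u_1,\dots,u_n)$ is divisible by $p$ for all integer values of the indeterminates $u_1,\dots,u_n$.
   Context: Let $\xi_1,\dots,\xi_n$ be an integral basis of $\mathcal{O}$, $u_1,\dots,u_n$ indeterminates, $w^{(0)}=u_1\xi_1+\cdots+u_n\xi_n$ the fundamental form and $w^{(0)},\dots,w^{(n-1)}$ its conjugates (replace the $\xi_i$ by their conjugates $\xi_i^{(\kappa)}$ under the $n$ embeddings of $K$). The discriminant of the fundamental equation $\prod_j(w-w^{(j)})=0$ factors as $$D(u_1,\dots,u_n)=\Delta(u_1,\dots,u_n)^2\,\big|\xi_i^{(\kappa)}\big|^2,$$ where $|\xi_i^{(\kappa)}|^2$ is the discriminant of $K$ and $\Delta$ is a homogeneous polynomial of degree $\frac{n(n-1)}2$ with integer coefficients having no common divisor (defined up to sign). For $\xi_0\in\mathcal{O}$ write $\xi_0^k=\sum_i a_{ik}\xi_i$ ($k=0,\dots,n-1$), $a_{ik}\in\mathbb{Z}$. The equation discriminant of $\xi_0$ (the discriminant of its degree $n$ characteristic equation) equals $|a_{ik}|^2$ times the discriminant of $K$. The prime $p$ is a common inessential discriminant divisor if $p$ divides the determinant $|a_{ik}|$ for every $\xi_0\in\mathcal{O}$. *)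

(* Defs.v *)
From HB Require Import structures.
From mathcomp Require Import all_boot all_order all_algebra all_field.
From mathcomp Require Export mpoly.

Set Implicit Arguments.
Unset Strict Implicit.
Unset Printing Implicit Defensive.

Import GRing.Theory.
Local Open Scope ring_scope.

(* A number field is a [K : fieldExtType rat]; its degree is [\dim {:K}].     *)

Definition in_ring_of_integers (K : fieldExtType rat) (x : K) : Prop :=
  integralOver (intr : int -> K) x.

Definition is_integral_basis (K : fieldExtType rat) (n : nat)
    (xi : 'I_n -> K) : Prop :=
  (forall i, in_ring_of_integers (xi i)) /\
  (forall x : K, in_ring_of_integers x ->
     exists! c : {ffun 'I_n -> int}, x = \sum_(i < n) (c i)%:~R * xi i).

(* Embeddings are taken into the field [algC] of complex algebraic numbers,   *)
(* which contains the image of every embedding of [K] into the complex field. *)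
(* As [{rmorphism _ -> _}] carries proofs, they are compared extensionally.   *)
Definition enumerates_embeddings (K : fieldExtType rat) (n : nat)
    (sigma : 'I_n -> {rmorphism K -> algC}) : Prop :=
  (forall k l : 'I_n, sigma k =1 sigma l -> k = l) /\
  (forall f : {rmorphism K -> algC}, exists k : 'I_n, f =1 sigma k).

Definition fundamental_form_conj (K : fieldExtType rat) (n : nat)
    (sigma : 'I_n -> {rmorphism K -> algC}) (xi : 'I_n -> K) (k : 'I_n) :
    {mpoly algC[n]} :=
  \sum_(i < n) sigma k (xi i) *: 'X_i.

(* The discriminant of the monic equation with roots [r 0, ..., r (n - 1)].   *)
Definition equation_disc (R : comNzRingType) (n : nat) (r : 'I_n -> R) : R :=
  \prod_(i < n) \prod_(j < n | (i < j)%N) (r i - r j) ^+ 2.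

Definition field_disc (K : fieldExtType rat) (n : nat)
    (sigma : 'I_n -> {rmorphism K -> algC}) (xi : 'I_n -> K) : algC :=
  (\det (\matrix_(i < n, k < n) sigma k (xi i))) ^+ 2.

Definition primitive_mpoly (n : nat) (q : {mpoly int[n]}) : Prop :=
  forall d : int, (forall m : 'X_{1..n}, (d %| q@_m)%Z) -> `|d| = 1.

(* [Delta] is determined up to sign by the last clause.                       *)
Definition is_primitive_disc_form (K : fieldExtType rat) (n : nat)
    (sigma : 'I_n -> {rmorphism K -> algC}) (xi : 'I_n -> K)
    (Delta : {mpoly int[n]}) : Prop :=
  [/\ Delta \is (n * n.-1)./2%N.-homog,
      primitive_mpoly Delta
    & equation_disc (fundamental_form_conj sigma xi) =
        map_mpoly intr Delta ^+ 2 * (field_disc sigma xi)%:MP].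

(* When [xi] is an integral basis, the matrix [a] exists and is unique for    *)
(* every integer [x0].                                                        *)
Definition common_inessential_disc_divisor (K : fieldExtType rat) (n : nat)
    (xi : 'I_n -> K) (p : nat) : Prop :=
  forall x0 : K, in_ring_of_integers x0 ->
  forall a : 'M[int]_n,
    (forall k : 'I_n, x0 ^+ k = \sum_(i < n) (a i k)%:~R * xi i) ->
    (p%:Z %| \det a)%Z.

(* Main.v *)
Require Import Defs.
From HB Require Import structures.
From mathcomp Require Import all_boot all_order all_algebra all_field.
From mathcomp Require Import mpoly.
Local Open Scope ring_scope.
Import GRing.Theory Num.Theory.

Set Implicit Arguments.
Unset Strict Implicit.

(** The divisibility statement reduces to an identity, valid for each integral
    element [x = \sum_i v i * xi i]: if [a] is the integer matrix expressing
    [1, x, ..., x ^ (n - 1)] in the basis [xi], then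
      [\det a ^+ 2 = Delta.@[v] ^+ 2].
    Both sides, multiplied by the discriminant of [K], are the discriminant of
    the characteristic equation of [x].  On the one hand this is the square of
    the Vandermonde determinant of the conjugates of [x], and the Vandermonde
    matrix is the transpose of [a] times the matrix of conjugates of [xi]
    ([equation_disc_index]); on the other hand it is the value at [v] of the
    discriminant of the fundamental equation ([equation_disc_meval]).

    The discriminant of [K] can be cancelled because it is nonzero
    ([fundamental_disc_neq0]).  If it vanished, then so would the discriminant of the
    fundamental equation, so two of the conjugate linear forms would coincide.
    The corresponding embeddings would then agree on integral elements, hence
    on [K], every element of which has a nonzero integral multiple
    ([integral_multiple]).

    Consequently [\det a] and [Delta.@[v]] agree up to sign.  As the integral
    elements correspond to the integer vectors [v], and the matrix [a] exists
    for each of them, [p] divides all the [\det a] exactly when it divides all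
    the values of [Delta]. *)

(** If [c] is the leading coefficient of [q] and [q] has degree [d > 0], then
    [c ^ (d - 1) q(x)] is a monic integer polynomial in [c x]. *)
Lemma integral_lead_coefM (R : comNzRingType) (q : {poly int}) (x : R) :
  (1 < size q)%N -> (map_poly intr q).[x] = 0 ->
  integralOver (intr : int -> R) ((lead_coef q)%:~R * x).
Proof.
rewrite horner_poly lead_coefE.
case: (size q) => [|[|d]] //= _; set c := q`_d.+1 => qx0.
pose r : {poly int} := \poly_(i < d.+1) (q`_i * c ^+ (d - i)).
exists ('X^(d.+1) + r).
  by rewrite monicE lead_coefDl ?lead_coefXn // size_polyXn ltnS size_poly.
rewrite rootE rmorphD /= map_polyXn hornerD hornerXn.
have -> : map_poly intr r =
    \poly_(i < d.+1) ((q`_i)%:~R * c%:~R ^+ (d - i)) :> {poly R}.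
  apply/polyP=> i; rewrite coef_map !coef_poly /=; case: ifP => // _.
  by rewrite intrM rmorphXn.
have {}qx0 := etrans (congr1 ( *%R (c%:~R ^+ d)) qx0) (mulr0 _).
apply/eqP; rewrite horner_poly; apply: etrans qx0.
rewrite [in RHS]big_ord_recr /= -/c.
rewrite mulrDr addrC mulr_sumr; congr (_ + _); last first.
  by rewrite exprMn mulrA -exprSr.
apply: eq_bigr => i _.
rewrite exprMn mulrA -[X in X * _]mulrA -exprD subnK; last by rewrite -ltnS.
by rewrite mulrCA mulrA.
Qed.

Lemma integral_multiple (K : fieldExtType rat) (x : K) :
  exists2 c : int, c != 0 & in_ring_of_integers (c%:~R * x).
Proof.
have /polyOver1P [p Dp] := minPolyOver 1%VS x.
have [q [a nz_a Dq]] := rat_poly_scale p.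
have intrK z : z%:~R = in_alg K z%:~R by rewrite rmorph_int.
have Dqp : map_poly intr q = a%:~R *: p.
  by rewrite Dq scalerA divff ?intr_eq0 // scale1r.
have Dqx : map_poly (intr : int -> K) q = a%:~R *: minPoly 1 x.
  have -> : map_poly intr q = map_poly (in_alg K) (map_poly intr q).
    by apply/polyP=> i; rewrite !coef_map /= intrK.
  by rewrite Dqp map_polyZ rmorph_int -Dp.
have sz_q : (1 < size q)%N.
  rewrite -size_rat_int_poly Dqp size_scale ?intr_eq0 //.
  by rewrite -(size_map_poly (in_alg K)) -Dp size_minPoly.
exists (lead_coef q).
  by rewrite lead_coef_eq0 -size_poly_gt0 (ltn_trans _ sz_q).
apply: integral_lead_coefM => //.
by rewrite Dqx hornerZ minPolyxx mulr0.
Qed.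

Lemma equation_disc_det (R : comNzRingType) (n : nat) (r : 'I_n -> R) :
  equation_disc r = \det (Vandermonde n (\row_k r k)) ^+ 2.
Proof.
rewrite det_Vandermonde -prodrXl; apply: eq_bigr => i _.
rewrite -prodrXl; apply: eq_bigr => j _.
by rewrite !mxE -sqrrN opprB.
Qed.

Lemma equation_disc_index (K : fieldExtType rat) (n : nat)
    (sigma : 'I_n -> {rmorphism K -> algC}) (xi : 'I_n -> K) (x : K)
    (a : 'M[int]_n) :
  (forall k : 'I_n, x ^+ k = \sum_(i < n) (a i k)%:~R * xi i) ->
  equation_disc (fun k => sigma k x) =
    (\det a)%:~R ^+ 2 * field_disc sigma xi.
Proof.
move=> Da; rewrite equation_disc_det /field_disc -exprMn; congr (_ ^+ 2).
rewrite -(det_tr a) -det_map_mx /= -det_mulmx; congr (\det _).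
apply/matrixP=> j k; rewrite !mxE -rmorphXn Da rmorph_sum.
by apply: eq_bigr => i _; rewrite rmorphM rmorph_int !mxE.
Qed.

Lemma rmorph_equation_disc (R S : comNzRingType) (f : {rmorphism R -> S})
    (n : nat) (r : 'I_n -> R) :
  f (equation_disc r) = equation_disc (fun k => f (r k)).
Proof.
rewrite rmorph_prod; apply: eq_bigr => i _.
by rewrite rmorph_prod; apply: eq_bigr => j _; rewrite rmorphXn rmorphB.
Qed.

Lemma meval_map_mpoly (R S : comNzRingType) (f : {rmorphism R -> S}) (n : nat)
    (v : 'I_n -> R) (q : {mpoly R[n]}) :
  (map_mpoly f q).@[fun i => f (v i)] = f q.@[v].
Proof.
elim/mpolyind: q => [|c m q _ _ IHq]; first by rewrite !rmorph0.
rewrite !rmorphD /= IHq map_mpolyZ map_mpolyX !mevalZ !mevalX rmorphM rmorph_prod.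
by congr (_ * _ + _); apply: eq_bigr => i _; rewrite rmorphXn.
Qed.

(** Specialising the indeterminates to [v] turns the conjugates of the
    fundamental form into the conjugates of [\sum_i v i * xi i]. *)
Lemma equation_disc_meval (K : fieldExtType rat) (n : nat)
    (sigma : 'I_n -> {rmorphism K -> algC}) (xi : 'I_n -> K) (v : 'I_n -> int) :
  (equation_disc (fundamental_form_conj sigma xi)).@[fun i => (v i)%:~R] =
    equation_disc (fun k => sigma k (\sum_(i < n) (v i)%:~R * xi i)).
Proof.
rewrite rmorph_equation_disc; apply: eq_bigr => i _; apply: eq_bigr => j _.
have Dw k : (fundamental_form_conj sigma xi k).@[fun i => (v i)%:~R] =
    sigma k (\sum_(i < n) (v i)%:~R * xi i).
  rewrite !rmorph_sum; apply: eq_bigr => l _ /=.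
  by rewrite mevalZ mevalXU rmorphM rmorph_int mulrC.
by congr ((_ - _) ^+ 2); apply: Dw.
Qed.

Lemma rmorph_eq_integral_basis (K : fieldExtType rat) (n : nat)
    (xi : 'I_n -> K) (f g : {rmorphism K -> algC}) :
  is_integral_basis xi -> (forall i, f (xi i) = g (xi i)) -> f =1 g.
Proof.
move=> [_ xi_basis] eq_fg x.
have [c nz_c /xi_basis[b [Dcx _]]] := integral_multiple x.
have cC_neq0 : c%:~R != 0 :> algC by rewrite intr_eq0.
apply: (mulfI cC_neq0); rewrite -{1}(rmorph_int f) -(rmorph_int g).
rewrite -!rmorphM Dcx !rmorph_sum; apply: eq_bigr => i _.
by rewrite !rmorphM !rmorph_int eq_fg.
Qed.

(** A vanishing factor would make two of the linear forms equal; comparing the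
    coefficients of the indeterminates, two distinct embeddings would agree on
    the integral basis. *)
Lemma fundamental_disc_neq0 (K : fieldExtType rat) (n : nat)
    (sigma : 'I_n -> {rmorphism K -> algC}) (xi : 'I_n -> K) :
  (forall k l : 'I_n, sigma k =1 sigma l -> k = l) -> is_integral_basis xi ->
  equation_disc (fundamental_form_conj sigma xi) != 0.
Proof.
move=> sigma_inj xi_basis.
apply/prodf_neq0=> i _; apply/prodf_neq0=> j lt_ij.
rewrite expf_eq0 subr_eq0 /=; apply/eqP=> eq_w.
suff eq_ij : i = j by rewrite eq_ij ltnn in lt_ij.
apply/sigma_inj/(rmorph_eq_integral_basis xi_basis) => l.
have coef_w k : (fundamental_form_conj sigma xi k)@_U_(l) = sigma k (xi l).
  rewrite raddf_sum (bigD1 l) //= big1 => [|m ne_ml].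
    by rewrite mcoeffZ mcoeffXU eqxx mulr1 addr0.
  by rewrite mcoeffZ mcoeffXU (negPf ne_ml) mulr0.
by rewrite -!coef_w eq_w.
Qed.

(** Both sides become the discriminant of the characteristic equation of
    [\sum_i v i * xi i] after multiplication by the nonzero discriminant of the
    field. *)
Lemma sqr_index_meval (K : fieldExtType rat) (n : nat)
    (sigma : 'I_n -> {rmorphism K -> algC}) (xi : 'I_n -> K)
    (Delta : {mpoly int[n]}) (v : 'I_n -> int) (a : 'M[int]_n) :
  (forall k l : 'I_n, sigma k =1 sigma l -> k = l) -> is_integral_basis xi ->
  equation_disc (fundamental_form_conj sigma xi) =
    map_mpoly intr Delta ^+ 2 * (field_disc sigma xi)%:MP ->
  (forall k : 'I_n, (\sum_(i < n) (v i)%:~R * xi i) ^+ k =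
     \sum_(i < n) (a i k)%:~R * xi i) ->
  \det a ^+ 2 = Delta.@[v] ^+ 2.
Proof.
move=> sigma_inj xi_basis DD Da.
have nzD : field_disc sigma xi != 0.
  apply: contraNneq (fundamental_disc_neq0 sigma_inj xi_basis) => D0.
  by rewrite DD D0 mulr0.
apply: (@intr_inj algC); apply: (mulIf nzD).
rewrite !rmorphXn -(equation_disc_index _ Da) -equation_disc_meval DD.
by rewrite rmorphM rmorphXn /= meval_map_mpoly mevalC.
Qed.

Theorem mainTheorem9 (K : fieldExtType rat) (n : nat) (hn : \dim {:K} = n)
    (sigma : 'I_n -> {rmorphism K -> algC})
    (hsigma : enumerates_embeddings sigma)
    (xi : 'I_n -> K) (hxi : is_integral_basis xi)
    (Delta : {mpoly int[n]})
    (hDelta : is_primitive_disc_form sigma xi Delta)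
    (p : nat) (hp : prime p) :
  common_inessential_disc_divisor xi p <->
  (forall v : 'I_n -> int, (p%:Z %| Delta.@[v])%Z).
Proof.
have [sigma_inj _] := hsigma; have [_ _ DD] := hDelta.
have [xi_int xi_span] := hxi.
have dvd_index (v : 'I_n -> int) (a : 'M[int]_n) :
    (forall k : 'I_n, (\sum_(i < n) (v i)%:~R * xi i) ^+ k =
       \sum_(i < n) (a i k)%:~R * xi i) ->
    (p%:Z %| \det a)%Z = (p%:Z %| Delta.@[v])%Z.
  move/(sqr_index_meval sigma_inj hxi DD)/eqP.
  by rewrite eqf_sqr => /orP[] /eqP-> //; rewrite dvdzE abszN.
split=> [p_index v | p_Delta x /xi_span[v [Dx _]] a Da]; last first.
  by rewrite (dvd_index v) // => k; rewrite -Dx Da.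
pose x := \sum_(i < n) (v i)%:~R * xi i.
have x_int : in_ring_of_integers x.
  apply: big_ind => [|y z|i _]; [exact: integral0|exact: integral_add|].
  by apply: integral_mul (xi_int i); apply: integral_id.
have xX_int k : in_ring_of_integers (x ^+ k).
  elim: k => [|k IHk]; first exact: integral1.
  by rewrite exprS; apply: integral_mul.
have /fin_all_exists[b Db] : forall k : 'I_n, exists c : {ffun 'I_n -> int},
    x ^+ k = \sum_(i < n) (c i)%:~R * xi i.
  by move=> k; have [c [Dc _]] := xi_span _ (xX_int k); exists c.
have Da (k : 'I_n) : x ^+ k = \sum_(i < n) ((\matrix_(i, k) b k i) i k)%:~R * xi i.
  by rewrite Db; apply: eq_bigr => i _; rewrite mxE.
by rewrite -(dvd_index v _ Da); apply: p_index x_int _ Da.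
Qed.
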